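(* (TES4 scheme.) Let $Q(t)\in\mathbb{C}^{N\times N}$ be sufficiently smooth and, with $Q,Q^{(1)},Q^{(2)}$ evaluated at $t$, set $$T(\tau)=\exp\left\{\frac{\tau^2}{12}Q^{(1)}+\frac{\tau^3}{48}Q^{(2)}\right\}\exp\left\{\tau Q\right\}\exp\left\{-\frac{\tau^2}{12}Q^{(1)}+\frac{\tau^3}{48}Q^{(2)}\right\}.$$ (a) As $\tau\to0$, up to $O(\tau^5)$, $$T(\tau)=E+\tau Q+\tfrac{\tau^2}{2}Q^2+\tfrac{\tau^3}{6}Q^3+\tfrac{\tau^3}{24}Q^{(2)}+\tfrac{\tau^3}{12}\left(Q^{(1)}Q-QQ^{(1)}\right)+\tfrac{\tau^4}{24}Q^4+\tfrac{\tau^4}{48}\left(QQ^{(2)}+Q^{(2)}Q\right)+\tfrac{\tau^4}{24}\left(Q^{(1)}Q^2-Q^2Q^{(1)}\right),$$ and the one-step scheme from $t-\tau/2$ to $t+\tau/2$ with transition matrix $T(\tau)$ has fourth order of accuracy for $dx/dt=Q(t)x$. (b) If $Q(t)$ is skew-Hermitian for all $t$, then $Q^{(1)}$ and $Q^{(2)}$ are skew-Hermitian, all three exponentials are unitary, and hence $T(\tau)$ preserves the quadratic invariant: $\|T(\tau)x\|^2=\|x\|^2$ for all $x\in\mathbb{C}^N$. (c) For the Zakharov–Shabat matrix $Q(t)=\begin{pmatrix}-i\zeta&q(t)\\-\sigma q(t)^*&i\zeta\end{pmatrix}$, $\sigma\in\{1,-1\}$, $\zeta\in\mathbb{C}$,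 the spectral parameter $\zeta$ enters $T(\tau)$ only through the factor $\exp\{\tau Q\}$; the other two factors do not depend on $\zeta$.
   Context: $E$ is the identity matrix, $Q^{(k)}=d^kQ/dt^k$, $\|\cdot\|$ is the Euclidean (Hermitian) norm, $q:\mathbb{R}\to\mathbb{C}$ is a potential independent of $\zeta$ and $q^*$ is its complex conjugate. A one-step scheme with transition matrix $T(\tau)$ from $t-\tau/2$ to $t+\tau/2$ has fourth order of accuracy for $dx/dt=Q(t)x$ if for every exact solution $x$ one has $x(t+\tau/2)=T(\tau)\,x(t-\tau/2)+O(\tau^5)$ as $\tau\to0$ with $t$ fixed. *)

(* Defs.v *)
From HB Require Import structures.
From mathcomp Require Import all_boot all_order all_algebra complex.
From mathcomp Require Import all_classical all_reals all_analysis.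
Set Implicit Arguments.
Unset Strict Implicit.
Unset Printing Implicit Defensive.
Import Order.TTheory GRing.Theory Num.Theory numFieldNormedType.Exports.
Local Open Scope classical_set_scope.
Local Open Scope complex_scope.
Local Open Scope ring_scope.

(* A matrix of complex functions of a real variable is differentiated entry by
   entry, through real and imaginary parts, since [derive1n] needs a
   codomain that is a normed module over R. *)
Definition mxderive (R : realType) (m n k : nat) (A : R -> 'M[R[i]]_(m, n))
    (t : R) : 'M[R[i]]_(m, n) :=
  \matrix_(i, j) (derive1n k (fun s => complex.Re (A s i j)) t
                  +i* derive1n k (fun s => complex.Im (A s i j)) t).

Definition Ck (R : realType) (k : nat) (f : R -> R) : Prop :=
  (forall l : nat, (l < k)%N -> forall t : R, derivable (derive1n l f) t 1) /\
  continuous (derive1n k f).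

Definition mxCk (R : realType) (m n k : nat) (A : R -> 'M[R[i]]_(m, n)) : Prop :=
  forall i j, Ck k (fun s => complex.Re (A s i j)) /\
              Ck k (fun s => complex.Im (A s i j)).

(* The regular module [R[i]^o] carries the topology given by the modulus; the
   limit is taken in the normed module of matrices over it. *)
Definition expmx (R : realType) (N : nat) (X : 'M[R[i]]_N) : 'M[R[i]]_N :=
  lim (series (fun k : nat => k`!%:R^-1 *: X ^+ k : 'M[R[i]^o]_N) @ \oo).

(* A(tau) = B(tau) + O(tau^p) as tau -> 0, for the (maximum) norm that the
   library puts on matrices; all norms are equivalent here. *)
Definition mx_eqO (R : realType) (m n p : nat) (A B : R -> 'M[R[i]]_(m, n)) :
    Prop :=
  (A : R -> 'M[R[i]^o]_(m, n)) = B +O_ (nbhs (0 : R))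
    (fun tau : R => (tau ^+ p)%:C : R[i]^o).

Definition ode_solution (R : realType) (N : nat) (Q : R -> 'M[R[i]]_N)
    (x : R -> 'cV[R[i]]_N) : Prop :=
  forall (t : R) (i : 'I_N),
    is_derive t 1 (fun s => complex.Re (x s i 0)) (complex.Re ((Q t *m x t) i 0)) /\
    is_derive t 1 (fun s => complex.Im (x s i 0)) (complex.Im ((Q t *m x t) i 0)).

(* Order at least p, i.e. a local error O(tau^(p+1)); [T t tau] is the transition
   matrix from t - tau/2 to t + tau/2. *)
Definition has_order (R : realType) (N p : nat) (Q : R -> 'M[R[i]]_N)
    (T : R -> R -> 'M[R[i]]_N) : Prop :=
  forall (t : R) (x : R -> 'cV[R[i]]_N), ode_solution Q x ->
    mx_eqO p.+1 (fun tau : R => x (t + tau / 2))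
                (fun tau : R => T t tau *m x (t - tau / 2)).

Definition tes4_left (R : realType) (N : nat) (Q : R -> 'M[R[i]]_N)
    (t tau : R) : 'M[R[i]]_N :=
  expmx ((tau ^+ 2 / 12)%:C *: mxderive 1 Q t + (tau ^+ 3 / 48)%:C *: mxderive 2 Q t).

Definition tes4_right (R : realType) (N : nat) (Q : R -> 'M[R[i]]_N)
    (t tau : R) : 'M[R[i]]_N :=
  expmx (- ((tau ^+ 2 / 12)%:C *: mxderive 1 Q t) + (tau ^+ 3 / 48)%:C *: mxderive 2 Q t).

Definition tes4_mid (R : realType) (N : nat) (Q : R -> 'M[R[i]]_N)
    (t tau : R) : 'M[R[i]]_N :=
  expmx (tau%:C *: Q t).

Definition tes4 (R : realType) (N : nat) (Q : R -> 'M[R[i]]_N)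
    (t tau : R) : 'M[R[i]]_N :=
  tes4_left Q t tau *m tes4_mid Q t tau *m tes4_right Q t tau.

(* [hermitianmx _ true conj] is the condition A = - A^t*. *)
Definition skew_hermitian (R : realType) (N : nat) (A : 'M[R[i]]_N) : Prop :=
  A \is hermitianmx N true Num.conj.

Definition hnorm (R : realType) (N : nat) (x : 'cV[R[i]]_N) : R :=
  Num.sqrt (\sum_(j < N) Normc.normc (x j 0) ^+ 2).

Definition zs_matrix (R : realType) (sigma : R[i]) (q : R -> R[i])
    (zeta : R[i]) (t : R) : 'M[R[i]]_2 :=
  \matrix_(j < 2, k < 2)
    if j == 0 then (if k == 0 then - ('i * zeta) else q t)
    else (if k == 0 then - (sigma * (q t)^*) else 'i * zeta).

(* Main.v *)
(* The three exponents are O(tau^2), O(tau), O(tau^2), so truncated exponential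
   series give the expansion of T(tau) modulo O(tau^5) as a product of
   polynomials in tau with matrix coefficients, multiplied by a truncated Cauchy
   product.  A solution x has x^(k) = W_k x with W_1 = Q, W_2 = Q' + Q^2,
   W_3 = Q'' + 2 Q' Q + Q Q' + Q^3, and five bounded derivatives because Q is C^4;
   Taylor expansion of x (t + tau/2) and x (t - tau/2) about t then reduces the
   order condition to noncommutative identities between the coefficients of
   tau^0, ..., tau^4, in which W_4 cancels by the symmetry of the scheme.

   For skew-Hermitian X, (exp X)^* = exp (- X), and exp X exp (- X) = 1.
   Differentiating q and the constants in the Zakharov-Shabat matrix entry by
   entry removes zeta from Q' and Q''. *)
Require Import Defs.
From HB Require Import structures.
From mathcomp Require Import all_boot all_order all_algebra complex.
From mathcomp Require Import all_classical all_reals all_analysis.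
From mathcomp Require Import ring lra.
Set Implicit Arguments.
Unset Strict Implicit.
Unset Printing Implicit Defensive.
Import Order.TTheory GRing.Theory Num.Theory numFieldNormedType.Exports.
Local Open Scope classical_set_scope.
Local Open Scope complex_scope.
Local Open Scope ring_scope.

(** * A submultiplicative norm on complex matrices *)

Section Norm1.
Context {R : realType}.
Implicit Types (z w : R[i]) (a : R).

Lemma Re_sum (I : Type) (r : seq I) (P : pred I) (F : I -> R[i]) :
  complex.Re (\sum_(i <- r | P i) F i) = \sum_(i <- r | P i) complex.Re (F i).
Proof. by apply: (big_morph (@complex.Re R)) => [[? ?] [? ?]|]. Qed.

Lemma Im_sum (I : Type) (r : seq I) (P : pred I) (F : I -> R[i]) :
  complex.Im (\sum_(i <- r | P i) F i) = \sum_(i <- r | P i) complex.Im (F i).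
Proof. by apply: (big_morph (@complex.Im R)) => [[? ?] [? ?]|]. Qed.

Lemma ReB z w : complex.Re (z - w) = complex.Re z - complex.Re w.
Proof. by case: z w => [? ?] [? ?]. Qed.

Lemma ImB z w : complex.Im (z - w) = complex.Im z - complex.Im w.
Proof. by case: z w => [? ?] [? ?]. Qed.

(* Equivalent to the modulus, but real-valued and submultiplicative without
   square roots. *)
Definition norm1 z : R := `|complex.Re z| + `|complex.Im z|.

Lemma norm1_ge0 z : 0 <= norm1 z. Proof. exact: addr_ge0. Qed.

Lemma norm10 : norm1 0 = 0. Proof. by rewrite /norm1 /= normr0 addr0. Qed.

Lemma norm1N z : norm1 (- z) = norm1 z.
Proof. by case: z => a b; rewrite /norm1 /= !normrN. Qed.

Lemma norm1D z w : norm1 (z + w) <= norm1 z + norm1 w.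
Proof.
by case: z w => [a b] [c d]; rewrite /norm1 /= addrACA lerD// ler_normD.
Qed.

Lemma norm1M z w : norm1 (z * w) <= norm1 z * norm1 w.
Proof.
case: z w => [a b] [c d]; rewrite /norm1 /=.
have h1 := ler_normB (a * c) (b * d); have h2 := ler_normD (a * d) (b * c).
move: h1 h2; rewrite !normrM; lra.
Qed.

Lemma norm1Z a z : norm1 (a%:C * z) = `|a| * norm1 z.
Proof.
by case: z => c d; rewrite /norm1 /= !mul0r subr0 addr0 !normrM mulrDr.
Qed.

Lemma norm1J z : norm1 z^* = norm1 z.
Proof. by case: z => a b; rewrite /norm1 /= normrN. Qed.

Lemma normc_le_norm1 z : `|z| <= (norm1 z)%:C.
Proof.
rewrite normc_def lecR -[leRHS]ger0_norm ?norm1_ge0// -sqrtr_sqr ler_wsqrtr//.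
rewrite /norm1; case: z => a b /=; rewrite sqrrD !real_normK ?num_real//.
by rewrite addrAC lerDl mulrn_wge0// mulr_ge0.
Qed.

(** The sum over all entries is submultiplicative for rectangular products, which the maximum norm
    is not. *)
Definition mxnorm1 m n (A : 'M[R[i]]_(m, n)) : R := \sum_i \sum_j norm1 (A i j).

Lemma mxnorm1_ge0 m n (A : 'M[R[i]]_(m, n)) : 0 <= mxnorm1 A.
Proof. by do 2![apply: sumr_ge0 => ? _]; exact: norm1_ge0. Qed.

Lemma norm1_le_mxnorm1 m n (A : 'M[R[i]]_(m, n)) i j : norm1 (A i j) <= mxnorm1 A.
Proof.
rewrite /mxnorm1 (bigD1 i)//= (bigD1 j)//= -addrA lerDl addr_ge0//.
  by apply: sumr_ge0 => ? _; exact: norm1_ge0.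
by do 2![apply: sumr_ge0 => ? _]; exact: norm1_ge0.
Qed.

Lemma mxnorm10 m n : mxnorm1 (0 : 'M[R[i]]_(m, n)) = 0.
Proof. by do 2![apply: big1 => ? _]; rewrite mxE norm10. Qed.

Lemma mxnorm1_eq0 m n (A : 'M[R[i]]_(m, n)) : mxnorm1 A <= 0 -> A = 0.
Proof.
move=> A0; apply/matrixP => i j; rewrite mxE; apply/eqP.
have := le_trans (norm1_le_mxnorm1 A i j) A0.
case: (A i j) => a b; rewrite /norm1 /= => ab0.
have := normr_ge0 a; have := normr_ge0 b => b0 a0.
rewrite eq_complex /= -[a == 0]normr_le0 -[b == 0]normr_le0.
by rewrite !(le_trans _ ab0)// ?lerDl ?lerDr.
Qed.

Lemma mxnorm1N m n (A : 'M[R[i]]_(m, n)) : mxnorm1 (- A) = mxnorm1 A.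
Proof. by do 2![apply: eq_bigr => ? _]; rewrite mxE norm1N. Qed.

Lemma mxnorm1D m n (A B : 'M[R[i]]_(m, n)) : mxnorm1 (A + B) <= mxnorm1 A + mxnorm1 B.
Proof.
rewrite /mxnorm1 -big_split; apply: ler_sum => i _ /=.
by rewrite -big_split; apply: ler_sum => j _ /=; rewrite mxE norm1D.
Qed.

Lemma mxnorm1C m n (A B : 'M[R[i]]_(m, n)) : mxnorm1 (A - B) = mxnorm1 (B - A).
Proof. by rewrite -mxnorm1N opprB. Qed.

Lemma mxnorm1_tri m n (B A C : 'M[R[i]]_(m, n)) :
  mxnorm1 (A - C) <= mxnorm1 (A - B) + mxnorm1 (B - C).
Proof. by rewrite (le_trans _ (mxnorm1D _ _))// addrA subrK. Qed.

Lemma mxnorm1_sum m n I (r : seq I) (P : pred I) (F : I -> 'M[R[i]]_(m, n)) :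
  mxnorm1 (\sum_(i <- r | P i) F i) <= \sum_(i <- r | P i) mxnorm1 (F i).
Proof.
elim/big_ind2: _ => [|A a B b Aa Bb|//]; first by rewrite mxnorm10.
by rewrite (le_trans (mxnorm1D _ _))// lerD.
Qed.

Lemma mxnorm1Z m n a (A : 'M[R[i]]_(m, n)) : mxnorm1 (a%:C *: A) = `|a| * mxnorm1 A.
Proof.
rewrite /mxnorm1 mulr_sumr; apply: eq_bigr => i _.
by rewrite mulr_sumr; apply: eq_bigr => j _; rewrite mxE norm1Z.
Qed.

(** The product of the two norms is a sum over pairs of entries with independent inner indices. The
    terms with equal inner indices already dominate the left side. *)
Lemma mxnorm1M m n p (A : 'M[R[i]]_(m, n)) (B : 'M[R[i]]_(n, p)) :
  mxnorm1 (A *m B) <= mxnorm1 A * mxnorm1 B.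
Proof.
rewrite /mxnorm1 mulr_suml; apply: ler_sum => i _.
have norm1_sum (F : 'I_n -> R[i]) : norm1 (\sum_k F k) <= \sum_k norm1 (F k).
  elim/big_ind2: _ => [|z a w b za wb|//]; first by rewrite norm10.
  by rewrite (le_trans (norm1D _ _))// lerD.
apply: (@le_trans _ _ (\sum_j \sum_k norm1 (A i k) * norm1 (B k j))).
  apply: ler_sum => j _; rewrite mxE (le_trans (norm1_sum _))//.
  by apply: ler_sum => k _; exact: norm1M.
rewrite exchange_big mulr_suml; apply: ler_sum => k _ /=.
rewrite -mulr_sumr ler_wpM2l ?norm1_ge0// [leRHS](bigD1 k)//= lerDl.
by do 2![apply: sumr_ge0 => ? _]; exact: norm1_ge0.
Qed.

Lemma mxnorm1_1 N : mxnorm1 (1%:M : 'M[R[i]]_N) = N%:R.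
Proof.
rewrite /mxnorm1 -[RHS](_ : \sum_(i < N) 1 = _); last first.
  by rewrite sumr_const card_ord.
apply: eq_bigr => i _; rewrite (bigD1 i)//= mxE eqxx big1 ?addr0.
  by rewrite /norm1 /= normr1 normr0 addr0.
by move=> j ji; rewrite mxE eq_sym (negbTE ji) norm10.
Qed.

(** The factor N is the norm of the identity and is what makes the bound hold at k = 0. *)
Lemma mxnorm1X N (X : 'M[R[i]]_N) k : mxnorm1 (X ^+ k) <= N%:R * mxnorm1 X ^+ k.
Proof.
elim: k => [|k IH]; first by rewrite !expr0 mxnorm1_1 mulr1.
by rewrite !exprSr mulrA (le_trans (mxnorm1M _ _))// ler_wpM2r ?mxnorm1_ge0.
Qed.

Lemma mxnorm1_adj m n (A : 'M[R[i]]_(m, n)) : mxnorm1 (A^T ^ Num.conj)%sesqui = mxnorm1 A.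
Proof.
rewrite /mxnorm1 exchange_big; apply: eq_bigr => i _; apply: eq_bigr => j _.
by rewrite !mxE; exact: norm1J.
Qed.

(** This comparison carries estimates over to the library norm, in which [expmx] and [mx_eqO] are
    stated. *)
Lemma mxnorm_le_mxnorm1 m n (A : 'M[R[i]^o]_(m, n)) :
  `|A| <= (mxnorm1 (A : 'M[R[i]]_(m, n)))%:C.
Proof.
rewrite [leLHS]/Num.Def.normr/= mx_normE.
elim/big_ind: _ => /= [|x y xA yA|[i j] _ /=].
- by rewrite ler0c mxnorm1_ge0.
- by rewrite /Order.max; case: ifP.
- by rewrite (le_trans (normc_le_norm1 _))// lecR norm1_le_mxnorm1.
Qed.

End Norm1.

Lemma cvg_mxnorm1 (R : realType) (I : Type) (F : set_system I) (FF : Filter F) m n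
    (A : I -> 'M[R[i]]_(m, n)) (L : 'M[R[i]]_(m, n)) :
  (forall i j, (fun k => complex.Re (A k i j)) @ F --> complex.Re (L i j)) ->
  (forall i j, (fun k => complex.Im (A k i j)) @ F --> complex.Im (L i j)) ->
  (fun k => mxnorm1 (A k - L)) @ F --> (0 : R).
Proof.
(* The limit is given the shape of the double sum, so that the limits of sums apply termwise. *)
move=> cRe cIm; rewrite (_ : 0 = \sum_(i < m) \sum_(j < n) (0 + 0 : R)).
  apply: cvg_big => [|i _]; first exact: add_continuous.
  apply: cvg_big => [|j _]; first exact: add_continuous.
  under eq_fun do rewrite !mxE /norm1 ReB ImB.
  rewrite -{1 2}(normr0 R); apply: cvgD; apply: cvg_norm.
    by rewrite -(subrr (complex.Re (L i j))); apply: cvgB => //; exact: cvg_cst.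
  by rewrite -(subrr (complex.Im (L i j))); apply: cvgB => //; exact: cvg_cst.
by rewrite big1// => i _; rewrite big1// => j _; rewrite addr0.
Qed.

(** * Convergence of the exponential series *)

Section Expmx.
Context {R : realType} {N : nat}.
Implicit Types X Y : 'M[R[i]]_N.

Definition expmx_sum X n : 'M[R[i]]_N :=
  \sum_(0 <= k < n) ((k`!%:R^-1 : R[i]) *: X ^+ k).

Lemma natrVc k : (k%:R^-1 : R[i]) = (k%:R^-1 : R)%:C.
Proof. by rewrite fmorphV rmorph_nat. Qed.

Lemma mxnorm1_exp_term X k :
  mxnorm1 ((k`!%:R^-1 : R[i]) *: X ^+ k) <= N%:R * exp_coeff (mxnorm1 X) k.
Proof.
rewrite natrVc mxnorm1Z ger0_norm ?invr_ge0// /exp_coeff /= mulrA [leRHS]mulrC.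
by rewrite ler_wpM2l ?invr_ge0// mxnorm1X.
Qed.

Lemma mxnorm1_expmx_sumB X n m : (n <= m)%N ->
  mxnorm1 (expmx_sum X m - expmx_sum X n) <=
  N%:R * (series (exp_coeff (mxnorm1 X)) m - series (exp_coeff (mxnorm1 X)) n).
Proof.
move=> nm; rewrite sub_series_geq// /expmx_sum (big_cat_nat (leq0n n) nm)//= addrAC subrr add0r.
rewrite (le_trans (mxnorm1_sum _ _ _))// mulr_sumr.
by apply: ler_sum => k _; exact: mxnorm1_exp_term.
Qed.

(** Real and imaginary parts of each entry are absolutely convergent real series, dominated by N
    times the exponential series of the norm. Completeness is thus used only in R. *)
Lemma expmx_sum_cvg X : exists L,
  (fun n => mxnorm1 (expmx_sum X n - L)) @ \oo --> (0 : R).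
Proof.
have cN : cvgn (series (fun k => N%:R * exp_coeff (mxnorm1 X) k)).
  exact: (@is_cvg_seriesZ R _ N%:R (is_cvg_series_exp_coeff (mxnorm1 X))).
have cf (f : nat -> R) :
    (forall k, `|f k| <= mxnorm1 ((k`!%:R^-1 : R[i]) *: X ^+ k)) -> cvgn (series f).
  move=> fX; apply: normed_cvg; apply: series_le_cvg cN => k /=; first exact: normr_ge0.
    by rewrite mulr_ge0// exp_coeff_ge0// mxnorm1_ge0.
  by rewrite (le_trans (fX k))// mxnorm1_exp_term.
have cRe i j : cvgn (fun n => complex.Re (expmx_sum X n i j)).
  under eq_fun do rewrite /expmx_sum summxE Re_sum.
  apply: cf => k; rewrite (le_trans _ (norm1_le_mxnorm1 _ i j))//.
  by rewrite /norm1 lerDl.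
have cIm i j : cvgn (fun n => complex.Im (expmx_sum X n i j)).
  under eq_fun do rewrite /expmx_sum summxE Im_sum.
  apply: cf => k; rewrite (le_trans _ (norm1_le_mxnorm1 _ i j))//.
  by rewrite /norm1 lerDr.
exists (\matrix_(i, j) (lim ((fun n => complex.Re (expmx_sum X n i j)) @ \oo)
                     +i* lim ((fun n => complex.Im (expmx_sum X n i j)) @ \oo))).
by apply: cvg_mxnorm1 => i j; rewrite mxE.
Qed.

Lemma expmx_cvg X : (fun n => mxnorm1 (expmx_sum X n - expmx X)) @ \oo --> (0 : R).
Proof.
have [L cL] := expmx_sum_cvg X.
suff -> : expmx X = L by [].
apply: (@cvg_lim _ (@norm_hausdorff _ 'M[R[i]^o]_(N, N))).
apply/cvgrPdist_le => e e0.
(* A positive element of [R[i]] is real, since the order compares only numbers with equal imaginary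
   parts. *)
have [r [r0 re]] : exists r : R, 0 < r /\ e = r%:C.
  by case: e e0 => a b; rewrite ltcE /= => /andP[/eqP-> a0]; exists a.
move/cvgrPdist_le : cL => /(_ _ r0); apply: filterS => n.
rewrite sub0r normrN ger0_norm ?mxnorm1_ge0// => nr.
rewrite (le_trans (mxnorm_le_mxnorm1 _))// re lecR mxnorm1C.
exact: nr.
Qed.

Lemma le_cvg0 (a b : R) (u : nat -> R) :
  u @ \oo --> (0 : R) -> (forall n, a <= u n + b) -> a <= b.
Proof.
move=> u0 au; have c : (fun n => u n + b) @ \oo --> 0 + b.
  by apply: cvgD => //; exact: cvg_cst.
rewrite -[b]add0r -(cvg_lim _ c)//; apply: limr_ge; first exact: cvgP c.
exact: nearW.
Qed.

Lemma expmx_unique X L :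
  (fun n => mxnorm1 (expmx_sum X n - L)) @ \oo --> (0 : R) -> expmx X = L.
Proof.
move=> cL; apply/eqP; rewrite -subr_eq0; apply/eqP/mxnorm1_eq0.
have c : (fun n => mxnorm1 (expmx X - expmx_sum X n) + mxnorm1 (expmx_sum X n - L))
    @ \oo --> (0 : R).
  rewrite -(addr0 0); apply: cvgD => //.
  by under eq_fun do rewrite mxnorm1C; exact: expmx_cvg.
by apply: (le_cvg0 c) => n; rewrite addr0 mxnorm1_tri.
Qed.

(** A crude bound by comparison with the shifted series; the power x^n is what the order estimates
    use. *)
Lemma exp_coeff_tail (x : R) n m : 0 <= x ->
  series (exp_coeff x) (n + m)%N - series (exp_coeff x) n <= x ^+ n * expR x.
Proof.
move=> x0; rewrite sub_series_geq ?leq_addr//.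
rewrite -{1}[n]add0n big_addn addKn.
apply: (@le_trans _ _ (x ^+ n * series (exp_coeff x) m)).
  rewrite /series /= mulr_sumr; apply: ler_sum => k _.
  rewrite /exp_coeff /= exprD [x ^+ k * _]mulrC -mulrA ler_wpM2l ?exprn_ge0//.
  (* (k + n)! >= k! *)
  rewrite ler_wpM2l ?exprn_ge0// lef_pV2 ?posrE ?ltr0n ?fact_gt0// ler_nat.
  by rewrite leq_fact ?leq_addr.
rewrite ler_wpM2l ?exprn_ge0//; apply: nondecreasing_cvgn_le.
  by apply: nondecreasing_series => k _ _; exact: exp_coeff_ge0.
exact: is_cvg_series_exp_coeff.
Qed.

(** The partial sums of lengths n and n + m differ by at most N times the scalar tail, uniformly in
    m. Letting m tend to infinity gives the bound. *)
Lemma expmx_remainder X n :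
  mxnorm1 (expmx X - expmx_sum X n) <= N%:R * (mxnorm1 X ^+ n * expR (mxnorm1 X)).
Proof.
have X0 := mxnorm1_ge0 X.
have c : (fun m => mxnorm1 (expmx_sum X (m + n) - expmx X)) @ \oo --> (0 : R).
  by have := expmx_cvg X; rewrite -(cvg_shiftn n).
apply: (le_cvg0 c) => m; rewrite addnC [X in _ <= X + _]mxnorm1C.
rewrite (le_trans (mxnorm1_tri (expmx_sum X (n + m)) _ _))// lerD2l.
rewrite (le_trans (mxnorm1_expmx_sumB _ (leq_addr _ _)))//.
by rewrite ler_wpM2l// exp_coeff_tail.
Qed.

End Expmx.

(** * Products of exponentials and unitarity *)

Lemma sum_triangle (V : nmodType) (f : nat -> nat -> V) n :
  \sum_(0 <= m < n) \sum_(0 <= i < m.+1) f i (m - i)%N =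
  \sum_(0 <= i < n) \sum_(0 <= j < n - i) f i j.
Proof.
elim: n => [|n IH]; first by rewrite !big_geq.
rewrite big_nat_recr//= IH [RHS]big_nat_recr//= subSnn big_nat1.
rewrite [X in _ + X]big_nat_recr//= subnn addrA; congr (_ + _).
rewrite -big_split /=; apply: eq_big_nat => i /andP[_ ni].
by rewrite subSn ?(ltnW ni)// big_nat_recr.
Qed.

(** Outside the triangle i + j < n the square keeps the corner i + j >= n. This serves both the
    product of exponentials and the product of truncated expansions. *)
Lemma sum_square_triangle (V : zmodType) (f : nat -> nat -> V) n :
  \sum_(0 <= i < n) \sum_(0 <= j < n) f i j
  - \sum_(0 <= m < n) \sum_(0 <= i < m.+1) f i (m - i)%N =
  \sum_(0 <= i < n) \sum_(n - i <= j < n) f i j.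
Proof.
rewrite sum_triangle -sumrB; apply: eq_bigr => i _.
by rewrite (big_cat_nat (leq0n (n - i)) (leq_subr _ _))/= addrAC subrr add0r.
Qed.

Lemma invf_fact_bin (F : numFieldType) m i : (i <= m)%N ->
  (m`!%:R^-1 : F) * 'C(m, i)%:R = i`!%:R^-1 * (m - i)`!%:R^-1.
Proof.
move=> im; rewrite -(bin_fact im) !natrM !invfM mulrAC mulVf ?mul1r//.
by rewrite pnatr_eq0 -lt0n bin_gt0.
Qed.

Section ExpmxD.
Context {R : realType} {N : nat}.
Implicit Types X Y : 'M[R[i]]_N.

Lemma exp_coeffD (x y : R) m :
  exp_coeff (x + y) m = \sum_(0 <= i < m.+1) exp_coeff x i * exp_coeff y (m - i)%N.
Proof.
rewrite /exp_coeff /= addrC exprDn mulr_suml big_mkord.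
apply: eq_bigr => i _; have im : (i <= m)%N by rewrite -ltnS.
transitivity (y ^+ (m - i) * x ^+ i * (m`!%:R^-1 * 'C(m, i)%:R)); first by ring.
by rewrite invf_fact_bin//; ring.
Qed.

Lemma expmx_termD X Y m : X *m Y = Y *m X ->
  (m`!%:R^-1 : R[i]) *: (X + Y) ^+ m =
  \sum_(0 <= i < m.+1)
     (i`!%:R^-1 *: X ^+ i) *m ((m - i)`!%:R^-1 *: Y ^+ (m - i)).
Proof.
(* The summands are swapped because the binomial formula puts the exponent m - i on the first
   one. *)
move=> XY; rewrite addrC exprDn_comm// scaler_sumr big_mkord.
apply: eq_bigr => i _; have im : (i <= m)%N by rewrite -ltnS.
rewrite -scalemxAl -scalemxAr !scalerA -invf_fact_bin// -[_ *+ 'C(_, _)]scaler_nat scalerA.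
congr (_ *: _).
have c : GRing.comm X Y by [].
by apply: commrX; apply: commr_sym; exact: commrX.
Qed.

(* The product of the partial sums minus the partial sum of the product is a sum
   over the pairs i + j >= n, dominated by the same sum for the real exponential
   series, which tends to 0 because exp (x + y) = exp x * exp y. *)
Lemma expmxD X Y : X *m Y = Y *m X -> expmx (X + Y) = expmx X *m expmx Y.
Proof.
move=> XY; apply: expmx_unique.
set x := mxnorm1 X; set y := mxnorm1 Y.
pose e (z : R) := series (exp_coeff z).
have ce z : e z @ \oo --> expR z by exact: is_cvg_series_exp_coeff.
have bound n : mxnorm1 (expmx_sum X n *m expmx_sum Y n - expmx_sum (X + Y) n) <=
    N%:R ^+ 2 * (e x n * e y n - e (x + y) n).
  rewrite /expmx_sum mulmx_suml; under eq_bigr do rewrite mulmx_sumr.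
  under [X in _ - X]eq_bigr do rewrite expmx_termD//.
  rewrite (sum_square_triangle
    (fun i j => (i`!%:R^-1 *: X ^+ i) *m (j`!%:R^-1 *: Y ^+ j))).
  rewrite /e /series /= mulr_suml; under [X in _ * (X - _)]eq_bigr do rewrite mulr_sumr.
  under [X in _ * (_ - X)]eq_bigr do rewrite exp_coeffD.
  rewrite (sum_square_triangle (fun i j => exp_coeff x i * exp_coeff y j)).
  rewrite (le_trans (mxnorm1_sum _ _ _))// mulr_sumr; apply: ler_sum => i _.
  rewrite (le_trans (mxnorm1_sum _ _ _))// mulr_sumr; apply: ler_sum => j _.
  rewrite (le_trans (mxnorm1M _ _))// expr2 mulrACA ler_pM ?mxnorm1_ge0//.
    exact: mxnorm1_exp_term.
  exact: mxnorm1_exp_term.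
pose u n := mxnorm1 (expmx_sum (X + Y) n - expmx X *m expmx Y).
(* The sequence [v] bounds [u] through the intermediate products of partial sums and of [expmx X]
   with a partial sum of Y. The inner sum in parentheses bounds the norm of [expmx_sum Y n]. *)
pose v n := N%:R ^+ 2 * (e x n * e y n - e (x + y) n) +
  (mxnorm1 (expmx_sum X n - expmx X) * (mxnorm1 (expmx_sum Y n - expmx Y) + mxnorm1 (expmx Y)) +
   mxnorm1 (expmx X) * mxnorm1 (expmx_sum Y n - expmx Y)).
have cv : v @ \oo --> (0 : R).
  rewrite [X in _ --> X](_ : 0 = N%:R ^+ 2 * (expR x * expR y - expR (x + y)) +
     (0 * (0 + mxnorm1 (expmx Y)) + mxnorm1 (expmx X) * 0)); last first.
    by rewrite expRD subrr mul0r !mulr0 !addr0.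
  have cX := expmx_cvg X; have cY := expmx_cvg Y.
  apply: cvgD; first by apply: cvgMl_tmp; apply: cvgB; [apply: cvgM; exact: ce|exact: ce].
  apply: cvgD; last exact: cvgMl_tmp.
  apply: cvgM; first exact: cX.
  by apply: cvgD; [exact: cY|exact: cvg_cst].
apply: (@squeeze_cvgr _ _ _ _ (fun=> 0) v) => //; last exact: cvg_cst.
apply: nearW => n; rewrite mxnorm1_ge0 /=.
rewrite (le_trans (mxnorm1_tri (expmx_sum X n *m expmx_sum Y n) _ _))//.
rewrite mxnorm1C lerD//.
rewrite (le_trans (mxnorm1_tri (expmx X *m expmx_sum Y n) _ _))//.
rewrite -mulmxBl -mulmxBr lerD ?mxnorm1M// (le_trans (mxnorm1M _ _))//.
rewrite ler_wpM2l ?mxnorm1_ge0// -[X in mxnorm1 X <= _](subrK (expmx Y)).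
exact: mxnorm1D.
Qed.

Lemma expmx0 : expmx (0 : 'M[R[i]]_N) = 1%:M.
Proof.
(* The shift by one drops the empty partial sum; all later ones equal the identity. *)
apply: expmx_unique; rewrite -cvg_shiftS; apply: cvg_near_cst.
apply: nearW => n /=; rewrite /expmx_sum big_nat_recl//= expr0 fact0 invr1 scale1r.
by rewrite big1 ?addr0 ?subrr ?mxnorm10// => k _; rewrite expr0n scaler0.
Qed.

Lemma adjmxX X k : ((X ^+ k)^t* = (X^t*) ^+ k)%sesqui.
Proof.
elim: k => [|k IH]; first by rewrite !expr0 trmx1 map_mx1.
by rewrite exprSr [RHS]exprS -IH trmx_mul map_mxM.
Qed.

Lemma adjmxZ m n (a : R) (A : 'M[R[i]]_(m, n)) :
  ((a%:C *: A)^t* = a%:C *: A^t*)%sesqui.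
Proof. by rewrite linearZ /= map_mxZ; congr (_ *: _); exact: conjc_real. Qed.

(** The coefficients 1/k! are real, so the adjoint commutes with partial sums; it also preserves
    [mxnorm1] and hence passes to the limit. *)
Lemma expmx_adj X : ((expmx X)^t* = expmx (X^t*))%sesqui.
Proof.
apply/esym/expmx_unique.
suff E n : expmx_sum (X^t*)%sesqui n = ((expmx_sum X n)^t*)%sesqui.
  under eq_fun do rewrite E -map_mxB -linearB mxnorm1_adj.
  exact: expmx_cvg.
rewrite /expmx_sum linear_sum raddf_sum /=; apply: eq_bigr => k _.
by rewrite natrVc adjmxZ adjmxX.
Qed.

Lemma skew_hermitianP X : skew_hermitian X <-> (X^t* = - X)%sesqui.
Proof.
split=> [/is_hermitianmxP {2}->|XE]; last apply/is_hermitianmxP.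
  by rewrite expr1 scaleN1r opprK.
by rewrite expr1 scaleN1r XE opprK.
Qed.

Lemma expmx_unitary X : skew_hermitian X -> expmx X \is unitarymx.
Proof.
move=> /skew_hermitianP XE; apply/unitarymxP.
by rewrite expmx_adj XE -expmxD ?mulmxN ?mulNmx// subrr expmx0.
Qed.

End ExpmxD.

(** * Invariance of the Hermitian norm under unitary matrices *)

Lemma hnormE (R : realType) N (x : 'cV[R[i]]_N) :
  (hnorm x ^+ 2)%:C = (((x^t*)%sesqui *m x) 0 0).
Proof.
rewrite /hnorm sqr_sqrtr ?sumr_ge0// => [|j _]; last exact: sqr_ge0.
rewrite mxE rmorph_sum; apply: eq_bigr => j _; rewrite !mxE.
case: (x j 0) => a b; rewrite /= sqr_sqrtr ?addr_ge0 ?sqr_ge0//.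
by rewrite -[_ * _]/(mulc (conjc (a +i* b)) (a +i* b)) /=; congr (_ +i* _); ring.
Qed.

Lemma unitarymx_hnorm (R : realType) N (U : 'M[R[i]]_N) (x : 'cV[R[i]]_N) :
  U \is unitarymx -> hnorm (U *m x) ^+ 2 = hnorm x ^+ 2.
Proof.
(* Membership in [unitarymx] reads U U^* = 1, while the norm needs U^* U = 1; this is the unitarity
   of the adjoint. *)
rewrite -trmxC_unitary => /unitarymxP; rewrite trmxCK => UU.
apply: complexI; rewrite !hnormE trmx_mul map_mxM mulmxA.
by rewrite -[_ *m _ *m U]mulmxA UU mulmx1.
Qed.

(** * Expansions modulo a power of tau *)

Section MatrixEntries.
Context {V : comNzRingType} {m n : nat}.
Implicit Types A B : 'M[V]_(m, n).

Lemma mxDE A B i j : (A + B) i j = A i j + B i j. Proof. by rewrite mxE. Qed.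
Lemma mxNE A i j : (- A) i j = - A i j. Proof. by rewrite mxE. Qed.
Lemma mxZE a A i j : (a *: A) i j = a * A i j. Proof. by rewrite mxE. Qed.
Lemma mx0E i j : (0 : 'M[V]_(m, n)) i j = 0. Proof. by rewrite mxE. Qed.

(** Passing to entries lets [field] decide identities that are linear in matrices. Noncommutative
    products are first generalized to atoms. *)
Definition mxlinE := (mxDE, mxNE, mxZE, mx0E).

End MatrixEntries.

(** Cauchy product of two coefficient sequences, with the order of the matrix factors kept. *)
Definition mxconv (K : pzRingType) m n l (T : nat -> 'M[K]_(m, n))
    (V : nat -> 'M[K]_(n, l)) (k : nat) : 'M[K]_(m, l) :=
  \sum_(0 <= i < k.+1) T i *m V (k - i)%N.

(** The products AB, BA and BB in X^2/2 have degrees 5 and 6. Subtracting them explicitly keeps the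
    identity exact, and they are discarded later as O(tau^5). *)
Lemma exp_quad_expansion (K : numFieldType) N (A B : 'M[K]_N) (t : K) :
  let X := t ^+ 2 *: A + t ^+ 3 *: B in
  1%:M + X + 2^-1 *: (X *m X)
    + (- (t ^+ 5 *: (2^-1 *: (A *m B + B *m A))) - t ^+ 6 *: (2^-1 *: (B *m B))) =
  1%:M + t ^+ 2 *: A + t ^+ 3 *: B + t ^+ 4 *: (2^-1 *: (A *m A)).
Proof.
move=> X; rewrite /X mulmxDl !mulmxDr -!scalemxAl -!scalemxAr.
move: (A *m A) (A *m B) (B *m A) (B *m B) 1%:M => AA AB BA BB E.
by apply/matrixP => i j; rewrite !mxlinE; field.
Qed.

(** * Landau estimates and truncated expansions *)

Section OrdO.
Context {R : realType}.

(** Landau's O(tau^p) at 0 with a real constant in the submultiplicative norm; C is nonnegative so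
    that bounds can be multiplied. *)
Definition ordO m n p (F : R -> 'M[R[i]]_(m, n)) : Prop :=
  exists2 C : R, 0 <= C & \forall tau \near (0 : R), mxnorm1 (F tau) <= C * `|tau| ^+ p.

Lemma near0_le1 : \forall tau \near (0 : R), `|tau| <= 1.
Proof.
by near=> tau; near: tau; apply: (@nbhs0_le _ R).
Unshelve. all: by end_near. Qed.

Lemma ordO_mx_eqO m n p (A B : R -> 'M[R[i]]_(m, n)) :
  ordO p (fun tau => A tau - B tau) -> mx_eqO p A B.
Proof.
move=> [C C0 AB]; apply/eqaddOP; near=> k; near=> tau.
rewrite (le_trans (mxnorm_le_mxnorm1 _))//.
(* The library's O quantifies over all large constants k in [R[i]], so k may be taken above the real
   C. *)
have k0 : C%:C <= k by near: k; apply: nbhs_pinfty_ge; apply/complex_realP; exists C.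
have : mxnorm1 (A tau - B tau) <= C * `|tau| ^+ p by near: tau.
rewrite -lecR => /le_trans; apply.
rewrite normc_def /= expr0n addr0 sqrtr_sqr normrX rmorphM/=.
by rewrite ler_wpM2r// ler0c exprn_ge0.
Unshelve. all: by end_near. Qed.

Lemma eq_ordO m n p (F G : R -> 'M[R[i]]_(m, n)) : F =1 G -> ordO p F -> ordO p G.
Proof. by move=> /funext->. Qed.

Lemma ordO_0 m n p : ordO p (fun _ => 0 : 'M[R[i]]_(m, n)).
Proof. by exists 0 => //; apply: filterE => tau; rewrite mxnorm10 mul0r. Qed.

Lemma ordO_le m n p q (F : R -> 'M[R[i]]_(m, n)) : (p <= q)%N -> ordO q F -> ordO p F.
Proof.
move=> pq [C C0 FC]; exists C => //; near=> tau.
have tau1 : `|tau| <= 1 by near: tau; exact: near0_le1.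
have /le_trans : mxnorm1 (F tau) <= C * `|tau| ^+ q by near: tau.
by apply; rewrite ler_wpM2l// ler_wiXn2l.
Unshelve. all: by end_near. Qed.

Lemma ordO_D m n p (F G : R -> 'M[R[i]]_(m, n)) :
  ordO p F -> ordO p G -> ordO p (fun tau => F tau + G tau).
Proof.
move=> [C C0 FC] [D D0 GD]; exists (C + D); first exact: addr_ge0.
near=> tau; rewrite (le_trans (mxnorm1D _ _))// mulrDl lerD//; by near: tau.
Unshelve. all: by end_near. Qed.

Lemma ordO_N m n p (F : R -> 'M[R[i]]_(m, n)) :
  ordO p F -> ordO p (fun tau => - F tau).
Proof. by move=> [C C0 FC]; exists C => //; apply: filterS FC => tau; rewrite mxnorm1N. Qed.

Lemma ordO_sum m n p I (r : seq I) (P : pred I) (F : I -> R -> 'M[R[i]]_(m, n)) :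
  (forall i, P i -> ordO p (F i)) -> ordO p (fun tau => \sum_(i <- r | P i) F i tau).
Proof.
move=> PF; elim: r => [|i r IH].
  by apply: eq_ordO (ordO_0 _ _ _) => tau; rewrite big_nil.
have [Pi|Pi] := boolP (P i); last first.
  by apply: eq_ordO IH => tau; rewrite big_cons (negbTE Pi).
by apply: eq_ordO (ordO_D (PF _ Pi) IH) => tau; rewrite big_cons Pi.
Qed.

Lemma ordO_M m n l p q (F : R -> 'M[R[i]]_(m, n)) (G : R -> 'M[R[i]]_(n, l)) :
  ordO p F -> ordO q G -> ordO (p + q) (fun tau => F tau *m G tau).
Proof.
move=> [C C0 FC] [D D0 GD]; exists (C * D); first exact: mulr_ge0.
near=> tau; rewrite (le_trans (mxnorm1M _ _))// exprD mulrACA.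
by rewrite ler_pM ?mxnorm1_ge0//; near: tau.
Unshelve. all: by end_near. Qed.

Lemma ordO_pow m n p q (A : 'M[R[i]]_(m, n)) :
  (p <= q)%N -> ordO p (fun tau : R => (tau ^+ q)%:C *: A).
Proof.
move=> pq; apply: (ordO_le pq); exists (mxnorm1 A); first exact: mxnorm1_ge0.
by apply: filterE => tau; rewrite mxnorm1Z normrX mulrC.
Qed.

Lemma ordO_scale m n p (a : R) (F : R -> 'M[R[i]]_(m, n)) :
  ordO p F -> ordO p (fun tau => F (a * tau)).
Proof.
move=> [C C0 FC]; exists (C * `|a| ^+ p); first by rewrite mulr_ge0// exprn_ge0.
have a0 : (fun tau : R => a * tau) @ (0 : R) --> (0 : R).
  by rewrite -[X in _ --> X](mulr0 a); apply: cvgMl_tmp; exact: cvg_id.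
have := a0 _ FC; apply: (@filterS _ (nbhs (0 : R))) => tau /=.
by rewrite normrM exprMn mulrA.
Qed.

(** Asymptotic expansion of F at 0 modulo O(tau^p). The coefficients form an infinite sequence, so
    that [mxconv] applies for every p. *)
Definition dev m n p (F : R -> 'M[R[i]]_(m, n)) (T : nat -> 'M[R[i]]_(m, n)) : Prop :=
  ordO p (fun tau => F tau - \sum_(0 <= k < p) (tau ^+ k)%:C *: T k).

Lemma dev_bounded m n p (F : R -> 'M[R[i]]_(m, n)) T : dev p F T -> ordO 0 F.
Proof.
move=> FT; apply: (@eq_ordO _ _ _
  (fun tau => (F tau - \sum_(0 <= k < p) (tau ^+ k)%:C *: T k)
              + \sum_(0 <= k < p) (tau ^+ k)%:C *: T k)) => [tau|].
  by rewrite subrK.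
apply: ordO_D; first exact: ordO_le FT.
by apply: ordO_sum => k _; exact: ordO_pow.
Qed.

Lemma eq_dev m n p (F G : R -> 'M[R[i]]_(m, n)) T V : F =1 G ->
  (forall k, (k < p)%N -> T k = V k) -> dev p F T -> dev p G V.
Proof.
move=> /funext<- TV; rewrite /dev; congr ordO; apply/funext => tau; congr (_ - _).
by apply: eq_big_nat => k /andP[_ kp]; rewrite TV.
Qed.

(** With P and S the truncations, FG - PS = (F - P) G + P (G - S), where G and P are bounded near 0.
    The product PS exceeds the truncated Cauchy product by terms of degree i + j >= p. *)
Lemma dev_M m n l p (F : R -> 'M[R[i]]_(m, n)) (G : R -> 'M[R[i]]_(n, l)) T V :
  dev p F T -> dev p G V -> dev p (fun tau => F tau *m G tau) (mxconv T V).
Proof.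
move=> FT GV; rewrite /dev.
pose P tau := \sum_(0 <= k < p) (tau ^+ k)%:C *: T k.
pose S tau := \sum_(0 <= k < p) (tau ^+ k)%:C *: V k.
pose f tau i j := ((tau ^+ i)%:C *: T i) *m ((tau ^+ j)%:C *: V j).
rewrite [X in ordO p X](_ : _ = fun tau => (F tau - P tau) *m G tau +
   (P tau *m (G tau - S tau) + \sum_(0 <= i < p) \sum_(p - i <= j < p) f tau i j)).
  apply: ordO_D; first by rewrite -[p]addn0; apply: ordO_M => //; exact: dev_bounded GV.
  apply: ordO_D.
    rewrite -[p]add0n; apply: ordO_M => //.
    by apply: ordO_sum => k _; exact: ordO_pow.
  apply: ordO_sum => i _.
  (* The range is repeated as a filter so that [ordO_sum] hands over p - i <= j. *)
  apply: (@eq_ordO _ _ _ (fun tau => \sum_(p - i <= j < p | (p - i <= j < p)%N) f tau i j)).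
    by move=> tau; rewrite [RHS]big_nat_cond; apply: eq_bigl => j; rewrite andbT.
  apply: ordO_sum => j /andP[ij _].
  rewrite [X in ordO p X](_ : _ = fun tau => (tau ^+ (i + j))%:C *: (T i *m V j)).
    by apply: ordO_pow; rewrite -leq_subLR.
  by apply/funext => tau; rewrite /f -scalemxAl -scalemxAr scalerA exprD rmorphM.
apply/funext => tau; rewrite -sum_square_triangle /f.
under [X in _ + (_ + (X - _))]eq_bigr do rewrite -mulmx_sumr.
rewrite -mulmx_suml mulmxBl mulmxBr -/(P tau) -/(S tau) !addrA !subrK.
congr (_ - _); apply: eq_bigr => k _; rewrite /mxconv scaler_sumr.
apply: eq_big_nat => i /andP[_ ik].
by rewrite -scalemxAl -scalemxAr scalerA -rmorphM -exprD subnKC.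
Qed.

Lemma dev_scale m n p (a : R) (F : R -> 'M[R[i]]_(m, n)) T :
  dev p F T -> dev p (fun tau => F (a * tau)) (fun k => (a ^+ k)%:C *: T k).
Proof.
move=> /(ordO_scale a); rewrite /dev; congr ordO; apply/funext => tau.
congr (_ - _); apply: eq_bigr => k _.
by rewrite exprMn rmorphM scalerA mulrC.
Qed.

Lemma dev_ordO m n p (F G : R -> 'M[R[i]]_(m, n)) T :
  dev p F T -> dev p G T -> ordO p (fun tau => F tau - G tau).
Proof.
move=> FT GT; have := ordO_D FT (ordO_N GT); congr ordO; apply/funext => tau.
by rewrite opprB addrA subrK.
Qed.

(** The remainder is bounded by N times the n-th power of the norm of X times its exponential. For
    tau at most 1 in modulus that exponential is at most exp C. *)
Lemma ordO_expmx_remainder N p n (X : R -> 'M[R[i]]_N) :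
  ordO p X -> ordO (p * n) (fun tau => expmx (X tau) - expmx_sum (X tau) n).
Proof.
move=> [C C0 XC]; exists (N%:R * (C ^+ n * expR C)).
  by rewrite !mulr_ge0// ?exprn_ge0// expR_ge0.
near=> tau; rewrite (le_trans (expmx_remainder _ _))//.
have tau1 : `|tau| <= 1 by near: tau; exact: near0_le1.
have XtC : mxnorm1 (X tau) <= C * `|tau| ^+ p by near: tau.
have X0 := mxnorm1_ge0 (X tau).
have XC1 : mxnorm1 (X tau) <= C.
  by rewrite (le_trans XtC)// ler_piMr// exprn_ile1.
rewrite -!mulrA ler_wpM2l// mulrCA mulrC ler_pM ?expR_ge0 ?exprn_ge0//.
  by rewrite ler_expR.
by rewrite mulrC exprM -exprMn mulrC lerXn2r ?nnegrE// mulr_ge0// exprn_ge0.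
Unshelve. all: by end_near. Qed.

Lemma dev_expmx_lin N p (A : 'M[R[i]]_N) :
  dev p (fun tau => expmx (tau%:C *: A)) (fun k => (k`!%:R^-1 : R[i]) *: A ^+ k).
Proof.
have X1 : ordO 1 (fun tau => tau%:C *: A).
  exact: (@ordO_pow _ _ 1 1).
have := ordO_expmx_remainder p X1; rewrite mul1n /dev.
congr ordO; apply/funext => tau; congr (_ - _); apply: eq_bigr => k _.
rewrite scalerA mulrC -scalerA; congr (_ *: _); rewrite rmorphXn/=.
elim: k => [|k IH]; first by rewrite !expr0 scale1r.
by rewrite !exprS IH -[_ * _]/(_ *m _) -scalemxAl -scalemxAr scalerA.
Qed.

Lemma dev_expmx_quad N (A B : 'M[R[i]]_N) :
  dev 5 (fun tau => expmx ((tau ^+ 2)%:C *: A + (tau ^+ 3)%:C *: B))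
    (nth 0 [:: 1%:M; 0; A; B; 2^-1 *: (A *m A)]).
Proof.
pose X tau := (tau ^+ 2)%:C *: A + (tau ^+ 3)%:C *: B.
have X2 : ordO 2 X by apply: ordO_D; exact: ordO_pow.
(* Three terms of the series suffice: the remainder is O(tau^6) because X is O(tau^2). *)
have XR : ordO 5 (fun tau => expmx (X tau) - expmx_sum (X tau) 3).
  exact: ordO_le (ordO_expmx_remainder 3 X2).
have Y : ordO 5 (fun tau : R => - ((tau ^+ 5)%:C *: (2^-1 *: (A *m B + B *m A)))
    - (tau ^+ 6)%:C *: (2^-1 *: (B *m B))).
  by apply: ordO_D; apply: ordO_N; exact: ordO_pow.
have := ordO_D XR (ordO_N Y); apply: eq_ordO => tau.
have := exp_quad_expansion A B tau%:C; rewrite -!rmorphXn /= -/(X tau) => E.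
rewrite /expmx_sum !big_nat_recr//= !big_geq// !factS fact0 !muln1/=.
rewrite -[X tau ^+ 0]/(1%:M) -[X tau ^+ 2]/(X tau *m X tau) expr0 expr1.
rewrite !add0r scaler0 addr0 invr1 !scale1r -E.
by rewrite [in RHS]opprD [in RHS]addrA.
Qed.

End OrdO.

(** * Coefficients of the scheme *)

Section Tes4Coefficients.
Context {K : numFieldType} {N : nat} (A B C : 'M[K]_N).

Definition exp_lin_coef k : 'M[K]_N := k`!%:R^-1 *: A ^+ k.

Definition exp_quad_coef (X Y : 'M[K]_N) : nat -> 'M[K]_N :=
  nth 0 [:: 1%:M; 0; X; Y; 2^-1 *: (X *m X)].

(** Here A, B, C stand for Q, Q', Q'' at t; the entries are the coefficients of tau^0 to tau^4 in
    the claimed expansion. *)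
Definition tes4_coef : nat -> 'M[K]_N := nth 0
  [:: 1%:M;
      A;
      2^-1 *: (A *m A);
      6^-1 *: (A *m A *m A) + 24^-1 *: C + 12^-1 *: (B *m A - A *m B);
      24^-1 *: (A *m A *m A *m A) + 48^-1 *: (A *m C + C *m A)
      + 24^-1 *: (B *m A *m A - A *m A *m B)].

Lemma tes4_coef_sum (t : K) : \sum_(0 <= k < 5) t ^+ k *: tes4_coef k =
  1%:M + t *: A + (t ^+ 2 / 2) *: A ^+ 2
  + (t ^+ 3 / 6) *: A ^+ 3 + (t ^+ 3 / 24) *: C
  + (t ^+ 3 / 12) *: (B *m A - A *m B)
  + (t ^+ 4 / 24) *: A ^+ 4
  + (t ^+ 4 / 48) *: (A *m C + C *m A)
  + (t ^+ 4 / 24) *: (B *m A ^+ 2 - A ^+ 2 *m B).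
Proof.
have -> : A ^+ 2 = A *m A by rewrite expr2.
have -> : A ^+ 3 = A *m A *m A by rewrite exprS expr2 -mulmxA.
have -> : A ^+ 4 = A *m A *m A *m A by rewrite exprS exprS expr2 -!mulmxA.
rewrite !big_nat_recr//= big_geq// add0r expr0 scale1r !mulmxA.
by rewrite !scalerDr !scalerA !addrA ?expr1.
Qed.

Lemma exp_lin_coefE k : (k < 5)%N -> exp_lin_coef k =
  nth 0 [:: 1%:M; A; 2^-1 *: (A *m A); 6^-1 *: (A *m A *m A);
            24^-1 *: (A *m A *m A *m A)] k.
Proof.
have AS l : A ^+ l.+1 = A ^+ l *m A by rewrite exprSr.
rewrite /exp_lin_coef; case: k => [|[|[|[|[|]]]]]//= _;
  rewrite ?AS -[A ^+ 0]/(1%:M) ?mul1mx ?invr1 ?scale1r//.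
Qed.

(** The B terms of the outer exponentials have opposite signs: they cancel at tau^2 and leave
    commutators with A and A^2 at tau^3 and tau^4, where the BB terms cancel too. The C terms have
    equal signs and add up. *)
Lemma conv_tes4_coef k : (k < 5)%N ->
  mxconv (mxconv (exp_quad_coef (12^-1 *: B) (48^-1 *: C)) exp_lin_coef)
       (exp_quad_coef (- (12^-1 *: B)) (48^-1 *: C)) k = tes4_coef k.
Proof.
pose E := nth 0 [:: 1%:M; A; 2^-1 *: (A *m A); 6^-1 *: (A *m A *m A);
            24^-1 *: (A *m A *m A *m A)].
(* The powers of A are replaced by explicit products, so that each of the five cases reduces to a
   finite sum of words. *)
move=> k5; rewrite [LHS](_ : _ = mxconv (mxconv (exp_quad_coef (12^-1 *: B) (48^-1 *: C)) E)
       (exp_quad_coef (- (12^-1 *: B)) (48^-1 *: C)) k); last first.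
  apply: eq_big_nat => i /andP[_ ik]; congr (_ *m _).
  apply: eq_big_nat => j /andP[_ jk]; congr (_ *m _).
  by apply: exp_lin_coefE; rewrite (leq_ltn_trans _ k5)// (leq_trans (leq_subr _ _)).
rewrite /mxconv; case: k k5 => [|[|[|[|[|]]]]]//= _;
  rewrite !big_nat_recr//= !big_geq//;
  rewrite ?subSS ?subn0 /tes4_coef /E /exp_quad_coef /=;
  rewrite ?(mul0mx, mulmx0, mul1mx, mulmx1, scaler0, add0r, addr0, mulmxN, mulNmx)//;
  rewrite -?scalemxAl -?scalemxAr ?mulmxN ?mulNmx -?scalemxAl -?scalemxAr ?mulmxA.
- by rewrite addrC addrK.
- move: (A *m A *m A) (A *m B) (B *m A) C => AAA AB BA C'.
  by apply/matrixP => i j; rewrite !mxlinE; field.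
- rewrite mulmxDl -!scalemxAl.
  move: (A *m A *m A *m A) (A *m A *m B) (B *m A *m A) (A *m C) (C *m A) (B *m B).
  move=> AAAA AAB BAA AC CA BB.
  by apply/matrixP => i j; rewrite !mxlinE; field.
Qed.

(* [V] lists the Taylor coefficients at [t] of a solution with value [x] at [t];
   [v4] is weighted by (tau/2)^4 at both ends of the step and so cancels. *)
Lemma mxconv_tes4_solution (x v4 : 'cV[K]_N) k : (k < 5)%N ->
  let V := nth 0 [:: x; A *m x; 2^-1 *: ((B + A *m A) *m x);
    6^-1 *: ((C + 2 *: (B *m A) + A *m B + A *m A *m A) *m x); v4] in
  mxconv tes4_coef (fun k => (- 2^-1) ^+ k *: V k) k = 2^-1 ^+ k *: V k.
Proof.
move=> + V; rewrite /mxconv; case: k => [|[|[|[|[|]]]]]//= _;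
  rewrite !big_nat_recr//= !big_geq// ?subSS ?subn0 /V /tes4_coef /=;
  (* Repeated passes expand nested sums and scalars until each term is a scalar times a
     left-associated word applied to x. *)
  rewrite ?(mul1mx, mulmxDl, mulmxDr, mulNmx, mulmxN) -?scalemxAl -?scalemxAr;
  rewrite ?(mul1mx, mulmxDl, mulmxDr, mulNmx, mulmxN) -?scalemxAl -?scalemxAr ?mulmxA;
  rewrite ?(mul1mx, mulmxDl, mulmxDr, mulNmx, mulmxN) -?scalemxAl -?scalemxAr ?mulmxA.
- by rewrite add0r !expr0.
- move: (A *m x) => Ax; by apply/matrixP => i j; rewrite add0r !mxlinE; field.
- move: (B *m x) (A *m A *m x) => Bx AAx.
  by apply/matrixP => i j; rewrite add0r !mxlinE; field.
- move: (C *m x) (B *m A *m x) (A *m B *m x) (A *m A *m A *m x) => Cx BAx ABx AAAx.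
  by apply/matrixP => i j; rewrite add0r !mxlinE; field.
- move: (A *m C *m x) (A *m B *m A *m x) (A *m A *m B *m x) (C *m A *m x).
  move: (B *m A *m A *m x) (A *m A *m A *m A *m x) => BAAx AAAAx ACx ABAx AABx CAx.
  by apply/matrixP => i j; rewrite add0r !mxlinE; field.
Qed.

End Tes4Coefficients.

Lemma tes4_leftE (R : realType) N (Q : R -> 'M[R[i]]_N) t tau :
  tes4_left Q t tau = expmx ((tau ^+ 2)%:C *: (12^-1 *: mxderive 1 Q t)
                           + (tau ^+ 3)%:C *: (48^-1 *: mxderive 2 Q t)).
Proof. by rewrite /tes4_left !scalerA !rmorphM /= !natrVc. Qed.

Lemma tes4_rightE (R : realType) N (Q : R -> 'M[R[i]]_N) t tau :
  tes4_right Q t tau = expmx ((tau ^+ 2)%:C *: (- (12^-1 *: mxderive 1 Q t))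
                            + (tau ^+ 3)%:C *: (48^-1 *: mxderive 2 Q t)).
Proof. by rewrite /tes4_right !scalerN !scalerA !rmorphM /= !natrVc. Qed.

Lemma dev_tes4 (R : realType) N (Q : R -> 'M[R[i]]_N) t :
  dev 5 (tes4 Q t) (tes4_coef (Q t) (mxderive 1 Q t) (mxderive 2 Q t)).
Proof.
have := dev_M (dev_M (dev_expmx_quad (12^-1 *: mxderive 1 Q t) (48^-1 *: mxderive 2 Q t))
  (dev_expmx_lin 5 (Q t)))
  (dev_expmx_quad (- (12^-1 *: mxderive 1 Q t)) (48^-1 *: mxderive 2 Q t)).
apply: eq_dev => [tau|k k5]; first by rewrite /tes4 -tes4_leftE -tes4_rightE.
exact: conv_tes4_coef.
Qed.

(** * Derivatives and Taylor expansions *)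

Section ComplexDerivative.
Context {R : realType}.
Implicit Types (f g : R -> R[i]) (t : R) (l k : R[i]).

Lemma eq_is_derive (u v : R -> R) (t a b : R) : u =1 v -> a = b ->
  is_derive t 1 u a -> is_derive t 1 v b.
Proof. by move=> /funext-> ->. Qed.

(** Two real derivatives encode the complex one, in the same form as in [ode_solution] and
    [mxderive]. *)
Definition cder f t l : Prop :=
  is_derive t 1 (fun s => complex.Re (f s)) (complex.Re l) /\
  is_derive t 1 (fun s => complex.Im (f s)) (complex.Im l).

Lemma eq_cder f g t l k : f =1 g -> l = k -> cder f t l -> cder g t k.
Proof. by move=> /funext-> ->. Qed.

Lemma cder_unique f t l k : cder f t l -> cder f t k -> l = k.
Proof.
move=> [fl1 fl2] [fk1 fk2]; apply/eqP; rewrite eq_complex.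
by rewrite -(@derive_val _ _ _ _ _ _ _ fl1) -(@derive_val _ _ _ _ _ _ _ fl2)
  (@derive_val _ _ _ _ _ _ _ fk1) (@derive_val _ _ _ _ _ _ _ fk2) !eqxx.
Qed.

Lemma cderN f t l : cder f t l -> cder (fun s => - f s) t (- l).
Proof.
move=> [fl1 fl2]; split.
  by apply: eq_is_derive (is_deriveN fl1) => [s|]; rewrite ?fctE raddfN.
by apply: eq_is_derive (is_deriveN fl2) => [s|]; rewrite ?fctE raddfN.
Qed.

Lemma ReJ l : complex.Re (Num.conj l) = complex.Re l. Proof. by case: l. Qed.

Lemma ImJ l : complex.Im (Num.conj l) = - complex.Im l. Proof. by case: l. Qed.

Lemma cderJ f t l : cder f t l -> cder (fun s => Num.conj (f s)) t (Num.conj l).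
Proof.
move=> [fl1 fl2]; split.
  by apply: eq_is_derive fl1 => [s|]; rewrite ReJ.
by apply: eq_is_derive (is_deriveN fl2) => [s|]; rewrite ?fctE ImJ.
Qed.

Lemma cderD f g t l k : cder f t l -> cder g t k -> cder (fun s => f s + g s) t (l + k).
Proof.
move=> [fl1 fl2] [gk1 gk2]; split.
  by apply: eq_is_derive (is_deriveD fl1 gk1) => [s|]; rewrite ?fctE raddfD.
by apply: eq_is_derive (is_deriveD fl2 gk2) => [s|]; rewrite ?fctE raddfD.
Qed.

Lemma cder_sum n (f : 'I_n -> R -> R[i]) t (l : 'I_n -> R[i]) :
  (forall i, cder (f i) t (l i)) -> cder (fun s => \sum_i f i s) t (\sum_i l i).
Proof.
move=> fl; have fl1 i := (fl i).1; have fl2 i := (fl i).2; split.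
  by apply: eq_is_derive (is_derive_sum fl1) => [s|]; rewrite ?fct_sumE Re_sum.
by apply: eq_is_derive (is_derive_sum fl2) => [s|]; rewrite ?fct_sumE Im_sum.
Qed.

Lemma ReD l k : complex.Re (l + k) = complex.Re l + complex.Re k.
Proof. by case: l k => [? ?] [? ?]. Qed.

Lemma ImD l k : complex.Im (l + k) = complex.Im l + complex.Im k.
Proof. by case: l k => [? ?] [? ?]. Qed.

Lemma ReM l k : complex.Re (l * k) =
  complex.Re l * complex.Re k - complex.Im l * complex.Im k.
Proof. by case: l k => [? ?] [? ?]. Qed.

Lemma ImM l k : complex.Im (l * k) =
  complex.Re l * complex.Im k + complex.Im l * complex.Re k.
Proof. by case: l k => [? ?] [? ?]. Qed.

Lemma cderM f g t l k : cder f t l -> cder g t k ->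
  cder (fun s => f s * g s) t (l * g t + f t * k).
Proof.
move=> [fl1 fl2] [gk1 gk2]; split.
  apply: eq_is_derive (is_deriveB (is_deriveM fl1 gk1) (is_deriveM fl2 gk2)) => [s|].
    by rewrite !fctE ReM.
  by rewrite ReD !ReM /GRing.scale /=; ring.
apply: eq_is_derive (is_deriveD (is_deriveM fl1 gk2) (is_deriveM fl2 gk1)) => [s|].
  by rewrite !fctE ImM.
by rewrite ImD !ImM /GRing.scale /=; ring.
Qed.

Lemma cder_pow (l : R[i]) (t : R) n :
  cder (fun s => (s ^+ n.+1)%:C * l) t (n.+1%:R * (t ^+ n)%:C * l).
Proof.
have X : is_derive t 1 (fun s : R => s ^+ n.+1) (n.+1%:R * t ^+ n).
  apply: eq_is_derive (is_deriveX n.+1 (is_derive_id t (1 : R))) => [s|].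
    by rewrite fctE.
  by rewrite /GRing.scale /= mulr1.
have E : n.+1%:R * (t ^+ n)%:C = (n.+1%:R * t ^+ n)%:C by rewrite rmorphM rmorph_nat.
rewrite E; case: l => a b; split; rewrite /= !mul0r ?subr0 ?addr0.
  by apply: eq_is_derive (is_deriveM X (is_derive_cst a t 1)) => [s|];
    rewrite ?fctE /GRing.scale /=; ring.
by apply: eq_is_derive (is_deriveM X (is_derive_cst b t 1)) => [s|];
    rewrite ?fctE /GRing.scale /=; ring.
Qed.

Lemma cder_shift f (a t : R) l : cder f (a + t) l -> cder (fun s => f (a + s)) t l.
Proof.
have S : is_derive t 1 (fun s : R => a + s) 1.
  apply: eq_is_derive (is_derive_shift t 1 a) => [s|//]; exact: addrC.
move=> [fl1 fl2]; split.
  by apply: eq_is_derive (is_derive1_comp fl1 S) => [s|]; rewrite ?fctE ?mulr1.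
by apply: eq_is_derive (is_derive1_comp fl2 S) => [s|]; rewrite ?fctE ?mulr1.
Qed.

(** The mean value theorem on the segment between 0 and tau: the intermediate point has modulus at
    most that of tau, whatever the sign of tau. *)
Lemma mean_value_bound (f f' : R -> R) (M tau : R) :
  (forall s : R, is_derive s 1 f (f' s)) -> (forall s, `|s| <= `|tau| -> `|f' s| <= M) ->
  `|f tau - f 0| <= M * `|tau|.
Proof.
move=> ff' f'M.
have cf (a b : R) : {within `[a, b], continuous f}.
  by apply: derivable_within_continuous => s _; by have [] := ff' s.
have [tau0|tau0] := leP 0 tau.
  have [c] := MVT_segment tau0 (fun s _ => ff' s) (cf _ _).
  rewrite in_itv /= => /andP[c0 ct] ->; rewrite subr0 normrM ler_wpM2r//.
  by apply: f'M; rewrite !ger0_norm.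
have [c] := MVT_segment (ltW tau0) (fun s _ => ff' s) (cf _ _).
rewrite in_itv /= => /andP[ct c0]; rewrite distrC => ->.
rewrite sub0r normrM normrN ler_wpM2r//.
by apply: f'M; rewrite !ler0_norm ?(ltW tau0)// lerN2.
Qed.

End ComplexDerivative.

(** * Matrix derivatives, integration of expansions, and smoothness *)

Section MatrixDerivative.
Context {R : realType}.

(** Differentiation everywhere, as a relation: derivatives are built by sum and product rules and
    then identified by uniqueness. *)
Definition mxder m n (F F' : R -> 'M[R[i]]_(m, n)) : Prop :=
  forall t i j, cder (fun s => F s i j) t (F' t i j).

Lemma eq_mxder m n (F G F' G' : R -> 'M[R[i]]_(m, n)) :
  F =1 G -> F' =1 G' -> mxder F F' -> mxder G G'.
Proof. by move=> /funext-> /funext->. Qed.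

Lemma mxder_unique m n (F F' G' : R -> 'M[R[i]]_(m, n)) :
  mxder F F' -> mxder F G' -> F' =1 G'.
Proof. by move=> FF' FG' t; apply/matrixP => i j; exact: cder_unique (FG' t i j). Qed.

Lemma mxderD m n (F G F' G' : R -> 'M[R[i]]_(m, n)) : mxder F F' -> mxder G G' ->
  mxder (fun t => F t + G t) (fun t => F' t + G' t).
Proof.
move=> FF' GG' t i j; apply: eq_cder (cderD (FF' t i j) (GG' t i j)) => [s|];
  by rewrite mxE.
Qed.

Lemma mxderN m n (F F' : R -> 'M[R[i]]_(m, n)) : mxder F F' ->
  mxder (fun t => - F t) (fun t => - F' t).
Proof.
by move=> FF' t i j; apply: eq_cder (cderN (FF' t i j)) => [s|]; rewrite mxE.
Qed.

Lemma mxder_adj m n (F F' : R -> 'M[R[i]]_(m, n)) : mxder F F' ->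
  mxder (fun t => (F t)^t*)%sesqui (fun t => (F' t)^t*)%sesqui.
Proof.
by move=> FF' t i j; apply: eq_cder (cderJ (FF' t j i)) => [s|]; rewrite !mxE.
Qed.

Lemma mxderM m n l (F F' : R -> 'M[R[i]]_(m, n)) (G G' : R -> 'M[R[i]]_(n, l)) :
  mxder F F' -> mxder G G' ->
  mxder (fun t => F t *m G t) (fun t => F' t *m G t + F t *m G' t).
Proof.
move=> FF' GG' t i j.
apply: eq_cder (cder_sum (fun k => cderM (FF' t i k) (GG' t k j))) => [s|].
  by rewrite mxE.
by rewrite !mxE -big_split.
Qed.

Lemma mxder_shift m n (a : R) (F F' : R -> 'M[R[i]]_(m, n)) : mxder F F' ->
  mxder (fun t => F (a + t)) (fun t => F' (a + t)).
Proof. by move=> FF' t i j; apply: (@cder_shift _ (fun s => F s i j)); exact: FF'. Qed.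

(** Arranged as an antiderivative of tau^k A, the form that termwise integration produces. *)
Lemma mxder_pow m n (A : 'M[R[i]]_(m, n)) k :
  mxder (fun t => (t ^+ k.+1)%:C *: (k.+1%:R^-1 *: A)) (fun t => (t ^+ k)%:C *: A).
Proof.
move=> t i j; apply: eq_cder (cder_pow (k.+1%:R^-1 * A i j) t k) => [s|].
  by rewrite !mxE.
rewrite !mxZE mulrAC mulVKf; first exact: mulrC.
by rewrite pnatr_eq0.
Qed.

Lemma mxder_cst m n (A : 'M[R[i]]_(m, n)) : mxder (fun _ => A) (fun _ => 0).
Proof. by move=> t i j; rewrite mxE; split; exact: is_derive_cst. Qed.

Lemma mxder_sum m n I (r : seq I) (F F' : I -> R -> 'M[R[i]]_(m, n)) :
  (forall i, mxder (F i) (F' i)) ->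
  mxder (fun t => \sum_(i <- r) F i t) (fun t => \sum_(i <- r) F' i t).
Proof.
move=> FF'; elim: r => [|i r IH].
  by apply: eq_mxder (mxder_cst 0) => t; rewrite big_nil.
by apply: eq_mxder (mxderD (FF' i) IH) => t; rewrite big_cons.
Qed.

Lemma continuous_ordO0 m n (F : R -> 'M[R[i]]_(m, n)) :
  (forall i j, continuous (fun s => complex.Re (F s i j))) ->
  (forall i j, continuous (fun s => complex.Im (F s i j))) ->
  forall t, ordO 0 (fun tau => F (t + tau)).
Proof.
move=> cRe cIm t; exists (1 + mxnorm1 (F t)); first by rewrite addr_ge0// mxnorm1_ge0.
have near_t : \forall s \near t, mxnorm1 (F s) <= 1 + mxnorm1 (F t).
  have := cvg_mxnorm1 (nbhs_filter t) (fun i j => cRe i j t) (fun i j => cIm i j t).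
  move/cvgrPdist_le => /(_ 1 ltr01); apply: filterS => s.
  rewrite sub0r normrN ger0_norm ?mxnorm1_ge0// => Fs.
  by rewrite -[F s](subrK (F t)) (le_trans (mxnorm1D _ _))// lerD2r.
have := (nbhs0P _ _).1 near_t; apply: (@filterS _ (nbhs (0 : R))) => tau.
by rewrite expr0 mulr1.
Qed.

Lemma mxder_ordO0 m n (F F' : R -> 'M[R[i]]_(m, n)) : mxder F F' ->
  forall t, ordO 0 (fun tau => F (t + tau)).
Proof.
move=> FF'; apply: continuous_ordO0 => i j t.
  by apply/differentiable_continuous/derivable1_diffP; have [[] ] := FF' t i j.
by apply/differentiable_continuous/derivable1_diffP; have [_ [] ] := FF' t i j.
Qed.

Lemma ordO_integrate m n p (F F' : R -> 'M[R[i]]_(m, n)) :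
  mxder F F' -> F 0 = 0 -> ordO p F' -> ordO p.+1 F.
Proof.
move=> FF' F0 [C C0 F'C].
(* The mean value theorem is applied to the real and the imaginary part of each entry, and each
   contributes one C. *)
exists (\sum_(i < m) \sum_(j < n) (C + C)).
  by do 2![apply: sumr_ge0 => ? _]; exact: addr_ge0.
(* An explicit ball is taken because the bound on F' is used at every s between 0 and tau. *)
have [d d0 dF'] := F'C.
exists d => //= tau; rewrite /= sub0r normrN => taud.
have bound s : `|s| <= `|tau| -> mxnorm1 (F' s) <= C * `|tau| ^+ p.
  move=> st; apply: (@le_trans _ _ (C * `|s| ^+ p)).
    by apply: dF'; rewrite /= sub0r normrN (le_lt_trans st).
  by rewrite ler_wpM2l// lerXn2r ?nnegrE.
rewrite mulr_suml; apply: ler_sum => i _.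
rewrite mulr_suml; apply: ler_sum => j _.
rewrite exprSr mulrDl !mulrA /norm1 lerD//.
  have := @mean_value_bound _ _ _ (C * `|tau| ^+ p) tau (fun s => (FF' s i j).1).
  rewrite F0 mxE subr0; apply => s /bound; apply: le_trans.
  by rewrite (le_trans _ (norm1_le_mxnorm1 _ i j))// lerDl.
have := @mean_value_bound _ _ _ (C * `|tau| ^+ p) tau (fun s => (FF' s i j).2).
rewrite F0 mxE subr0; apply => s /bound; apply: le_trans.
by rewrite (le_trans _ (norm1_le_mxnorm1 _ i j))// lerDr.
Qed.

(** F minus the integrated polynomial vanishes at 0 and has as derivative the remainder of F', so
    its order rises by one. *)
Lemma dev_integrate m n p (F F' : R -> 'M[R[i]]_(m, n)) T :
  mxder F F' -> dev p F' T ->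
  dev p.+1 F (fun k => if k is k'.+1 then k'.+1%:R^-1 *: T k' else F 0).
Proof.
move=> FF' F'T; rewrite /dev.
apply: (@eq_ordO _ _ _ _ (fun tau => F tau + (- F 0
    - \sum_(0 <= k < p) (tau ^+ k.+1)%:C *: (k.+1%:R^-1 *: T k)))) => [tau|].
  by rewrite big_nat_recl//= expr0 scale1r opprD.
apply: (ordO_integrate _ _ F'T).
  apply: mxderD => //.
  apply: (@eq_mxder _ _ _ _ (fun tau => 0 - \sum_(0 <= k < p) (tau ^+ k)%:C *: T k)
     _ (frefl _)) => [tau|]; first by rewrite add0r.
  apply: mxderD; first exact: mxder_cst.
  by apply/mxderN/mxder_sum => k; exact: mxder_pow.
rewrite addrA subrr sub0r big1 ?oppr0// => k _.
by rewrite expr0n scale0r.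
Qed.

(** Existence of k successive derivatives, the last one locally bounded. Local boundedness is what
    remainder estimates consume, and sums and products preserve it. *)
Fixpoint smooth m n k (F : R -> 'M[R[i]]_(m, n)) : Prop :=
  if k is k'.+1 then exists F', mxder F F' /\ smooth k' F'
  else forall t, ordO 0 (fun tau => F (t + tau)).

Lemma smooth_le m n k l (F : R -> 'M[R[i]]_(m, n)) :
  (k <= l)%N -> smooth l F -> smooth k F.
Proof.
elim: l k F => [|l IH] [|k] F //=; first by move=> _ [F' [/mxder_ordO0 FO _]].
by move=> kl [F' [FF' F's]]; exists F'; split => //; exact: IH F's.
Qed.

Lemma smoothD m n k (F G : R -> 'M[R[i]]_(m, n)) :
  smooth k F -> smooth k G -> smooth k (fun t => F t + G t).
Proof.
elim: k F G => [|k IH] F G /=; first by move=> Fs Gs t; exact: ordO_D.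
move=> [F' [FF' F's]] [G' [GG' G's]]; exists (fun t => F' t + G' t).
by split; [exact: mxderD|exact: IH].
Qed.

Lemma smoothM m n l k (F : R -> 'M[R[i]]_(m, n)) (G : R -> 'M[R[i]]_(n, l)) :
  smooth k F -> smooth k G -> smooth k (fun t => F t *m G t).
Proof.
elim: k F G => [|k IH] F G /=.
  by move=> Fs Gs t; have := ordO_M (Fs t) (Gs t); rewrite addn0.
move=> Fk Gk; have Fs := smooth_le (leqnSn k) Fk; have Gs := smooth_le (leqnSn k) Gk.
case: Fk Gk => [F' [FF' F's]] [G' [GG' G's]].
exists (fun t => F' t *m G t + F t *m G' t).
by split; [exact: mxderM|apply: smoothD; exact: IH].
Qed.

End MatrixDerivative.

(** * Properties of the TES4 scheme *)

Section Tes4.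
Context {R : realType}.

Lemma mxderive0 m n (Q : R -> 'M[R[i]]_(m, n)) t : mxderive 0 Q t = Q t.
Proof. by apply/matrixP => i j; rewrite mxE /derive1n /=; case: (Q t i j). Qed.

Lemma mxCk_mxder m n p k (Q : R -> 'M[R[i]]_(m, n)) : mxCk p Q -> (k < p)%N ->
  mxder (mxderive k Q) (mxderive k.+1 Q).
Proof.
move=> QC kp t i j; have [[dRe _] [dIm _]] := QC i j; split.
  under eq_fun do rewrite mxE /=.
  by rewrite mxE /= derive1E; apply/derivableP/dRe.
under eq_fun do rewrite mxE /=.
by rewrite mxE /= derive1E; apply/derivableP/dIm.
Qed.

Lemma mxCk_smooth m n p k (Q : R -> 'M[R[i]]_(m, n)) : mxCk p Q -> (k <= p)%N ->
  smooth (p - k) (mxderive k Q).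
Proof.
(* Induction on the number d = p - k of derivatives still available. *)
move=> QC; move: {2}(p - k)%N (erefl (p - k)%N) => d; elim: d k => [|d IH] k.
  move=> pk kp; rewrite pk; have {pk kp}-> : k = p.
    by apply/eqP; rewrite eqn_leq kp -subn_eq0 pk /=.
  apply: continuous_ordO0 => i j; have [[_ cRe] [_ cIm]] := QC i j.
    by under eq_fun do rewrite mxE.
  by under eq_fun do rewrite mxE.
move=> pk _; have kp : (k < p)%N by rewrite -subn_gt0 pk.
rewrite pk; exists (mxderive k.+1 Q); split; first exact: mxCk_mxder QC kp.
have pk1 : (p - k.+1)%N = d by rewrite subnS pk.
by rewrite -pk1; exact: IH.
Qed.

Lemma ode_solution_mxder N (Q : R -> 'M[R[i]]_N) (x : R -> 'cV[R[i]]_N) :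
  ode_solution Q x -> mxder x (fun t => Q t *m x t).
Proof. by move=> Qx t i j; rewrite ord1; exact: Qx. Qed.

(** Bootstrapping through x' = Qx: smoothness of x at one level makes the right side equally smooth,
    hence x one level smoother. *)
Lemma ode_solution_smooth N k (Q : R -> 'M[R[i]]_N) (x : R -> 'cV[R[i]]_N) :
  ode_solution Q x -> smooth k Q -> smooth k.+1 x.
Proof.
move=> /ode_solution_mxder xQ; elim: k => [|k IH] Qk.
  exists (fun t => Q t *m x t); split => //.
  by apply: smoothM => //; exact: mxder_ordO0 xQ.
exists (fun t => Q t *m x t); split => //; apply: smoothM => //.
by apply: IH; exact: smooth_le Qk.
Qed.

Lemma dev_smooth2 m n (F : R -> 'M[R[i]]_(m, n)) t : smooth 2 F ->
  exists V, dev 2 (fun tau => F (t + tau)) V /\ V 0%N = F t.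
Proof.
move=> [F' [FF' [F2 [F'F2 /(_ t) F2O]]]].
(* An expansion of order 0 is an empty sum, so boundedness of the second derivative starts two
   integrations. *)
have F2dev : dev 0 (fun tau => F2 (t + tau)) (fun _ => 0).
  by apply: eq_ordO F2O => tau; rewrite big_geq// subr0.
eexists; split.
  exact: dev_integrate (mxder_shift t FF') (dev_integrate (mxder_shift t F'F2) F2dev).
by rewrite /= addr0.
Qed.

(** The third derivative of x is a polynomial in Q, Q', Q'' applied to x, and Q'' has two
    derivatives left. Its expansion of order 2, integrated three times, gives order 5. *)
Lemma dev_ode_solution N (Q : R -> 'M[R[i]]_N) (x : R -> 'cV[R[i]]_N) t :
  mxCk 4 Q -> ode_solution Q x ->
  let A := Q t in let B := mxderive 1 Q t in let C := mxderive 2 Q t in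
  exists v4, dev 5 (fun tau => x (t + tau))
    (nth 0 [:: x t; A *m x t; 2^-1 *: ((B + A *m A) *m x t);
      6^-1 *: ((C + 2 *: (B *m A) + A *m B + A *m A *m A) *m x t); v4]).
Proof.
move=> QC xQ; have dx := ode_solution_mxder xQ; move=> A B C.
have Qs : smooth 4 Q.
  rewrite (_ : Q = mxderive 0 Q); first exact: (mxCk_smooth (k := 0) QC).
  by apply/funext => s; rewrite mxderive0.
have dQ : mxder Q (mxderive 1 Q).
  by apply: (eq_mxder (mxderive0 Q) (frefl _)); exact: (mxCk_mxder QC).
have dQ1 : mxder (mxderive 1 Q) (mxderive 2 Q) by exact: (mxCk_mxder QC).
pose x2 s := (mxderive 1 Q s + Q s *m Q s) *m x s.
pose x3 s := (mxderive 2 Q s + 2 *: (mxderive 1 Q s *m Q s) + Q s *m mxderive 1 Q s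
  + Q s *m Q s *m Q s) *m x s.
have d2 : mxder (fun s => Q s *m x s) x2.
  by apply: eq_mxder (mxderM dQ dx) => s //; rewrite /x2 mulmxDl mulmxA.
have d3 : mxder x2 x3.
  apply: eq_mxder (mxderM (mxderD dQ1 (mxderM dQ dQ)) dx) => s //.
  rewrite mulmxA -mulmxDl; congr (_ *m _); rewrite mulmxDl scaler_nat mulr2n.
  rewrite !addrA; congr (_ + _); rewrite -!addrA; congr (_ + _).
  by congr (_ + _); exact: addrC.
have x3s : smooth 2 x3.
  have Q_s := smooth_le (isT : 2 <= 4)%N Qs.
  have x_s : smooth 2 x by apply: (ode_solution_smooth xQ); exact: smooth_le Qs.
  have Q1_s : smooth 2 (mxderive 1 Q) 
    by apply: (@smooth_le _ _ _ 2 3) => //; exact: (mxCk_smooth (k := 1) QC).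
  have Q2_s : smooth 2 (mxderive 2 Q) by exact: (mxCk_smooth (k := 2) QC).
  apply: smoothM => //; apply: smoothD; last by do 2?apply: smoothM.
  apply: smoothD; last exact: smoothM.
  apply: smoothD => //.
  (* The multiple by 2 is written as a sum, to which [smoothD] applies. *)
  rewrite (_ : (fun _ => _) =
    fun s => mxderive 1 Q s *m Q s + mxderive 1 Q s *m Q s).
    by apply: smoothD; exact: smoothM.
  by apply/funext => s; rewrite scaler_nat mulr2n.
have [V [V3 V0]] := dev_smooth2 t x3s.
have xdev := dev_integrate (mxder_shift t dx) (dev_integrate (mxder_shift t d2)
  (dev_integrate (mxder_shift t d3) V3)).
(* [V 1%N] is the linear coefficient of the third derivative; each integration divides by the next
   degree. *)
exists (4^-1 *: (3^-1 *: (2^-1 *: V 1%N))).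
apply: eq_dev xdev => // -[|[|[|[|[|k]]]]]//= _.
- by rewrite addr0.
- by rewrite addr0 invr1 scale1r.
- by rewrite /x2 addr0 invr1 scale1r.
- rewrite V0 /x3 invr1 scale1r scalerA; congr (_ *: _).
  by rewrite -invfM -natrM.
Qed.

(** One expansion about the midpoint t, rescaled by 1/2 and -1/2, describes both ends of the step.
    Equal coefficients up to tau^4 leave a difference O(tau^5). *)
Lemma tes4_has_order4 N (Q : R -> 'M[R[i]]_N) : mxCk 4 Q -> has_order 4 Q (tes4 Q).
Proof.
move=> QC t x xQ; apply: ordO_mx_eqO.
have [v4 xdev] := dev_ode_solution t QC xQ.
have half tau : t + tau / 2 = t + 2^-1 * tau by rewrite mulrC.
have nhalf tau : t - tau / 2 = t + - 2^-1 * tau by rewrite mulNr mulrC.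
have xp := dev_scale 2^-1 xdev; have xm := dev_scale (- 2^-1) xdev.
have Tx := dev_M (dev_tes4 Q t) xm.
apply: eq_ordO (dev_ordO xp (eq_dev _ _ Tx)) => [tau||k k5].
- by rewrite half nhalf.
- by [].
- have := mxconv_tes4_solution (Q t) (mxderive 1 Q t) (mxderive 2 Q t) (x t) v4 k5.
  have E (z : R) : (z ^+ k)%:C = z%:C ^+ k by rewrite rmorphXn.
  rewrite E -natrVc => <-.
  apply: eq_bigr => i _; congr (_ *m (_ *: _)).
  by rewrite rmorphXn rmorphN /= -natrVc.
Qed.

Lemma tes4_expansion N (Q : R -> 'M[R[i]]_N) (t : R) :
  let Q0 := Q t in let Q1 := mxderive 1 Q t in let Q2 := mxderive 2 Q t in
  mx_eqO 5 (fun tau : R => tes4 Q t tau)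
    (fun tau : R =>
       1%:M + tau%:C *: Q0 + (tau ^+ 2 / 2)%:C *: Q0 ^+ 2
       + (tau ^+ 3 / 6)%:C *: Q0 ^+ 3 + (tau ^+ 3 / 24)%:C *: Q2
       + (tau ^+ 3 / 12)%:C *: (Q1 *m Q0 - Q0 *m Q1)
       + (tau ^+ 4 / 24)%:C *: Q0 ^+ 4
       + (tau ^+ 4 / 48)%:C *: (Q0 *m Q2 + Q2 *m Q0)
       + (tau ^+ 4 / 24)%:C *: (Q1 *m Q0 ^+ 2 - Q0 ^+ 2 *m Q1)).
Proof.
move=> Q0 Q1 Q2; apply: ordO_mx_eqO; apply: eq_ordO (dev_tes4 Q t) => tau.
congr (_ - _).
have c p n : (tau ^+ p / n%:R)%:C = tau%:C ^+ p / n%:R.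
  by rewrite rmorphM rmorphXn fmorphV rmorph_nat.
rewrite !c; have := tes4_coef_sum Q0 Q1 Q2 tau%:C => <-.
by apply: eq_bigr => k _; rewrite rmorphXn.
Qed.

(** The adjoint of the k-th derivative and its negative are the same function of t, so their
    derivatives agree by uniqueness. *)
Lemma skew_hermitian_mxderive N (Q : R -> 'M[R[i]]_N) k : mxCk 4 Q -> (k < 4)%N ->
  (forall t, skew_hermitian (mxderive k Q t)) ->
  forall t, skew_hermitian (mxderive k.+1 Q t).
Proof.
move=> QC k4 Qskew t; apply/skew_hermitianP.
have dQ := mxCk_mxder QC k4.
have dQadj : mxder (fun s => (mxderive k Q s)^t*)%sesqui (fun s => - mxderive k.+1 Q s).
  by apply: eq_mxder (frefl _) (mxderN dQ) => s; apply/esym/skew_hermitianP.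
exact: (mxder_unique (mxder_adj dQ) dQadj t).
Qed.

Lemma skew_hermitianD N (A B : 'M[R[i]]_N) :
  skew_hermitian A -> skew_hermitian B -> skew_hermitian (A + B).
Proof.
move=> /skew_hermitianP AE /skew_hermitianP BE; apply/skew_hermitianP.
by rewrite linearD /= map_mxD AE BE opprD.
Qed.

Lemma skew_hermitianZ N (a : R) (A : 'M[R[i]]_N) :
  skew_hermitian A -> skew_hermitian (a%:C *: A).
Proof.
by move=> /skew_hermitianP AE; apply/skew_hermitianP; rewrite adjmxZ AE scalerN.
Qed.

Lemma eq_tes4_left N (Q P : R -> 'M[R[i]]_N) t tau :
  mxderive 1 Q t = mxderive 1 P t -> mxderive 2 Q t = mxderive 2 P t ->
  tes4_left Q t tau = tes4_left P t tau.
Proof. by rewrite /tes4_left => -> ->. Qed.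

Lemma eq_tes4_right N (Q P : R -> 'M[R[i]]_N) t tau :
  mxderive 1 Q t = mxderive 1 P t -> mxderive 2 Q t = mxderive 2 P t ->
  tes4_right Q t tau = tes4_right P t tau.
Proof. by rewrite /tes4_right => -> ->. Qed.

(** The value 0 of zeta serves as the representative free of zeta: zeta sits only in diagonal
    entries constant in t, whose derivatives of order at least 1 vanish. *)
Lemma mxderive_zs_matrix (sigma zeta : R[i]) (q : R -> R[i]) k t :
  mxderive k.+1 (zs_matrix sigma q zeta) t = mxderive k.+1 (zs_matrix sigma q 0) t.
Proof.
have cst0 (a : R) : derive1n k.+1 (fun _ : R => a) = fun=> 0.
  elim: k => [|k IH]; first by apply/funext => s; rewrite derive1n1 derive1_cst.
  by rewrite derive1nS IH; apply/funext => s; rewrite derive1_cst.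
apply/matrixP => i j; rewrite !mxE.
under eq_fun do rewrite mxE; under [X in _ +i* derive1n _ X _]eq_fun do rewrite mxE.
under [in RHS]eq_fun do rewrite mxE.
under [X in _ = _ +i* derive1n _ X _]eq_fun do rewrite mxE.
by case: (i == 0); case: (j == 0); rewrite ?cst0.
Qed.

End Tes4.

Theorem mainTheorem5 (R : realType) :
  (* (a) *)
  (forall (N : nat) (Q : R -> 'M[R[i]]_N), mxCk 4 Q ->
     (forall t : R,
        let Q0 := Q t in
        let Q1 := mxderive 1 Q t in
        let Q2 := mxderive 2 Q t in
        mx_eqO 5 (fun tau : R => tes4 Q t tau)
          (fun tau : R =>
             1%:M + tau%:C *: Q0 + (tau ^+ 2 / 2)%:C *: Q0 ^+ 2
             + (tau ^+ 3 / 6)%:C *: Q0 ^+ 3 + (tau ^+ 3 / 24)%:C *: Q2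
             + (tau ^+ 3 / 12)%:C *: (Q1 *m Q0 - Q0 *m Q1)
             + (tau ^+ 4 / 24)%:C *: Q0 ^+ 4
             + (tau ^+ 4 / 48)%:C *: (Q0 *m Q2 + Q2 *m Q0)
             + (tau ^+ 4 / 24)%:C *: (Q1 *m Q0 ^+ 2 - Q0 ^+ 2 *m Q1)))
     /\ has_order 4 Q (tes4 Q)) /\
  (* (b) *)
  (forall (N : nat) (Q : R -> 'M[R[i]]_N), mxCk 4 Q ->
     (forall t : R, skew_hermitian (Q t)) ->
     forall t : R,
       skew_hermitian (mxderive 1 Q t) /\
       skew_hermitian (mxderive 2 Q t) /\
       forall tau : R,
         tes4_left Q t tau \is unitarymx /\
         tes4_mid Q t tau \is unitarymx /\
         tes4_right Q t tau \is unitarymx /\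
         forall x : 'cV[R[i]]_N,
           hnorm (tes4 Q t tau *m x) ^+ 2 = hnorm x ^+ 2) /\
  (* (c) *)
  (forall (sigma : R[i]) (q : R -> R[i]), sigma = 1 \/ sigma = -1 ->
     Ck 4 (fun s => complex.Re (q s)) -> Ck 4 (fun s => complex.Im (q s)) ->
     exists A B : R -> R -> 'M[R[i]]_2,
       forall (zeta : R[i]) (t tau : R),
         let Q := zs_matrix sigma q zeta in
         tes4_left Q t tau = A t tau /\
         tes4_right Q t tau = B t tau /\
         tes4 Q t tau = A t tau *m expmx (tau%:C *: Q t) *m B t tau).
Proof.
split; [|split].
- move=> N Q QC; split; [exact: tes4_expansion|exact: tes4_has_order4].
- move=> N Q QC Qskew t.
  have Q1skew : forall t, skew_hermitian (mxderive 1 Q t).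
    by apply: skew_hermitian_mxderive => // s; rewrite mxderive0.
  have Q2skew : forall t, skew_hermitian (mxderive 2 Q t).
    exact: skew_hermitian_mxderive.
  split=> //; split=> // tau.
  have lU : tes4_left Q t tau \is unitarymx.
    by apply/expmx_unitary/skew_hermitianD; exact: skew_hermitianZ.
  have mU : tes4_mid Q t tau \is unitarymx.
    by apply/expmx_unitary/skew_hermitianZ.
  have rU : tes4_right Q t tau \is unitarymx.
    apply/expmx_unitary/skew_hermitianD; last exact: skew_hermitianZ.
    (* The sign is absorbed into the real scalar, as real multiples stay skew-Hermitian. *)
    by rewrite -scaleNr -rmorphN; exact: skew_hermitianZ.
  do 3![split => //] => x.
  by apply: unitarymx_hnorm; exact: mul_unitarymx (mul_unitarymx lU mU) rU.
- move=> sigma q _ _ _.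
  (* The outer factors computed at zeta = 0 serve for every zeta. *)
  exists (tes4_left (zs_matrix sigma q 0)), (tes4_right (zs_matrix sigma q 0)).
  move=> zeta t tau Q.
  have QE (k : nat) : mxderive k.+1 Q t = mxderive k.+1 (zs_matrix sigma q 0) t.
    exact: mxderive_zs_matrix.
  have lE : tes4_left Q t tau = tes4_left (zs_matrix sigma q 0) t tau.
    exact: (eq_tes4_left tau (QE 0%N) (QE 1%N)).
  have rE : tes4_right Q t tau = tes4_right (zs_matrix sigma q 0) t tau.
    exact: (eq_tes4_right tau (QE 0%N) (QE 1%N)).
  by split; [exact: lE|split; [exact: rE|rewrite /tes4 lE rE]].
Qed.
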